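(* Let $\log_+y:=\log(\max\{y,e\})$ for $y\ge0$, and for all $p>1$ and $q>0$ define $$\mathcal{E}_p:=\{(x,y)\in(0,\infty)^2: y\ge x(\log_+x)^p\},\qquad \widetilde{\mathcal{E}}_q:=\{(x,y)\in(0,\infty)^2: y\ge x^q\}.$$ Then, for all $p>1$ and $q>0$, $\mathrm{Dim}_{\rm H}(\mathcal{E}_p)=1+p^{-1}$, and $$\mathrm{Dim}_{\rm H}(\widetilde{\mathcal{E}}_q)=\begin{cases}2&\text{if }0<q\le1,\\ 1&\text{if }q>1.\end{cases}$$
   Context: Macroscopic Hausdorff dimension (Barlow–Taylor) on $\mathbb{R}^2$. For integers $k\ge0$ let $\mathcal{V}_k:=(-e^k,e^k]^2$, $\mathcal{S}_0:=\mathcal{V}_0$, $\mathcal{S}_{k+1}:=\mathcal{V}_{k+1}\setminus\mathcal{V}_k$. For $\rho>0$ and $A\subseteq\mathbb{R}^2$ let $\nu^k_\rho(A):=\inf\sum_{i=1}^m (r_i/e^{k+1})^\rho$, the infimum being over all finite coverings of $A\cap\mathcal{S}_k$ by squares $Q_1,\dots,Q_m\subseteq\mathcal{S}_k$, where $Q_i$ has the form $(x_1,x_1+r_i]\times(x_2,x_2+r_i]$ with $r_i\ge1$. Then $\mathrm{Dim}_{\rm H}(A):=\inf\{\rho>0:\sum_{k=1}^\infty\nu^k_\rho(A)<\infty\}$. *)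

(* Defs.v *)
From HB Require Import structures.
From mathcomp Require Import all_boot all_order all_algebra.
From mathcomp Require Import all_classical all_reals all_analysis.

Set Implicit Arguments.
Unset Strict Implicit.
Unset Printing Implicit Defensive.

Import Order.TTheory GRing.Theory Num.Theory.
Import numFieldNormedType.Exports.

Local Open Scope classical_set_scope.
Local Open Scope ring_scope.

Definition square {R : realType} (x : R * R) (r : R) : set (R * R) :=
  `]x.1, x.1 + r] `*` `]x.2, x.2 + r].

Definition box {R : realType} (k : nat) : set (R * R) :=
  `]- expR k%:R, expR k%:R] `*` `]- expR k%:R, expR k%:R].

Definition shell {R : realType} (k : nat) : set (R * R) :=
  if k is j.+1 then box j.+1 `\` box j else box 0.

(* The empty covering (m = 0) is allowed, so that the content of the empty set
   is 0; the infimum over no covering at all is +oo. *)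
Definition macro_content {R : realType} (rho : R) (k : nat) (A : set (R * R))
    : \bar R :=
  ereal_inf [set c : \bar R |
    exists (m : nat) (x : 'I_m -> R * R) (r : 'I_m -> R),
      [/\ forall i, 1 <= r i,
          forall i, square (x i) (r i) `<=` shell k,
          A `&` shell k `<=` \bigcup_(i in [set: 'I_m]) square (x i) (r i)
        & c = (\sum_(i < m) (r i / expR k.+1%:R) `^ rho)%:E]].

Definition macro_hausdorff_dim {R : realType} (A : set (R * R)) : \bar R :=
  ereal_inf [set rho%:E | rho in [set rho : R |
    0 < rho /\ (\sum_(1 <= k <oo) macro_content rho k A < +oo)%E]].

Definition log_plus {R : realType} (y : R) : R := ln (Num.max y (expR 1)).

Definition log_epigraph {R : realType} (p : R) : set (R * R) :=
  [set z | [/\ 0 < z.1, 0 < z.2 & z.1 * log_plus z.1 `^ p <= z.2]].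

Definition power_epigraph {R : realType} (q : R) : set (R * R) :=
  [set z | [/\ 0 < z.1, 0 < z.2 & z.1 `^ q <= z.2]].

(* Main.v *)
Require Import Defs.
From HB Require Import structures.
From mathcomp Require Import all_boot all_order all_algebra.
From mathcomp Require Import all_classical all_reals all_analysis.
From mathcomp Require Import ring lra.

Set Implicit Arguments.
Unset Strict Implicit.
Unset Printing Implicit Defensive.

Import Order.TTheory GRing.Theory Num.Theory.
Import numFieldNormedType.Exports.

Local Open Scope classical_set_scope.
Local Open Scope ring_scope.

(** A set close to the vertical axis meets the shell [S_(j+1)] in roughly the
    strip [(0, d_j e^j] x (e^j, e^(j+1)]], where [d_j] is its relative width at
    height [e^j]: about [j^-p] for the logarithmic epigraph and
    [e^(- j (1 - 1/q))] for the power epigraph with [q > 1].  The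
    content of a thin strip has the order [d_j ^ (rho - 1)], so the dimension
    is the exponent at which the series of the [d_j ^ (rho - 1)] starts to
    converge.

    The upper bound for the content covers the strip by about [1 / d_j]
    squares as wide as the strip ([macro_content_rect_le]).  The lower bound
    is a mass distribution argument with Lebesgue measure: a square of side
    [r] captures at most [r * min (r, w)] of the area of a strip of width
    [w], and for [1 <= s <= 2] this is at most [r ^ s * w ^ (2 - s)]
    ([mul_min_powR_le], [macro_content_rect_ge]).  Being uniform in [s], the
    two bounds yield the criteria [macro_hausdorff_dim_le_strip] and
    [macro_hausdorff_dim_ge_strip].

    With [d_j] of order [j^-p] the series is that of [j^(- p (rho - 1))],
    convergent exactly when [rho > 1 + 1/p].  With [d_j] exponentially small
    it converges as soon as [rho > 1], and dimension at least 1 is witnessed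
    by the vertical strip of width 1, whose exponent [s - 1 = 0] leaves the
    constant series.  For [q <= 1] the strip with [d_j = 1] is contained in
    the set, which forces dimension at least 2; no set exceeds 2, because a
    shell is covered by about [e^(2k)] unit squares
    ([macro_hausdorff_dim_le2]). *)

(** * Rectangles, boxes and shells *)

Definition rect {R : realType} (a : R * R) (w h : R) : set (R * R) :=
  `]a.1, a.1 + w] `*` `]a.2, a.2 + h].

Lemma rectP (R : realType) (a : R * R) (w h : R) (z : R * R) :
  rect a w h z <-> (a.1 < z.1 <= a.1 + w) /\ (a.2 < z.2 <= a.2 + h).
Proof. by rewrite /rect /= !in_itv. Qed.

Lemma boxP (R : realType) (k : nat) (z : R * R) :
  box k z <-> (- expR k%:R < z.1 <= expR k%:R) /\
              (- expR k%:R < z.2 <= expR k%:R).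
Proof. by rewrite /box /= !in_itv. Qed.

Lemma shell_sub_box (R : realType) (k : nat) : @shell R k `<=` box k.
Proof. by case: k => [//|k] z []. Qed.

(** That [e] is at least 2 makes a shell wide enough for unit squares, and
    makes [e^(k+1)] dominate the side [2 e^k] of the box. *)
Lemma expR1_ge2 (R : realType) : 2 <= expR 1 :> R.
Proof. by have := expR_ge1Dx (1 : R). Qed.

Lemma expRS (R : realType) (j : nat) :
  expR j.+1%:R = expR 1 * expR j%:R :> R.
Proof. by rewrite -expRD nat1r. Qed.

Lemma expR_nat_ge1 (R : realType) (j : nat) : 1 <= expR j%:R :> R.
Proof. by rewrite -expR0 ler_expR. Qed.

Lemma expRS_ge2 (R : realType) (j : nat) :
  2 * expR j%:R <= expR j.+1%:R :> R.
Proof. by rewrite expRS ler_wpM2r ?expR_ge0// expR1_ge2. Qed.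

(** * Coverings by squares *)

(** Segments of the one length [s] that must stay inside [(0, w]]: multiples of
    [s] serve as left ends, except that the last segment is pushed back to
    start at [w - s].  This costs only a factor 2 in the total length. *)
Lemma segment_cover (R : realType) (w s : R) : 0 < s -> s <= w ->
  exists (n : nat) (c : 'I_n -> R), [/\ n%:R * s <= 2 * w,
    forall i, 0 <= c i <= w - s &
    forall t, 0 < t <= w -> exists i, c i < t <= c i + s].
Proof.
move=> s0 sw; have w0 : 0 <= w / s by rewrite divr_ge0// ltW// (lt_le_trans s0).
exists (Num.truncn (w / s)).+1, (fun i => Num.min (i%:R * s) (w - s)); split.
- have := @truncn_le _ (w / s); rewrite w0 ler_pdivlMr// -natr1 => ?; lra.
- move=> i; rewrite ge_min lexx orbT andbT le_min subr_ge0 sw andbT.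
  by rewrite mulr_ge0// ltW.
- move=> t /andP[t0 tw].
  (* The index of the segment containing t is the ceiling of t / s minus 1. *)
  have c0 : 0 < Num.ceil (t / s) by rewrite ceil_gt0 divr_gt0.
  have [n cn] : exists n : nat, Num.ceil (t / s) = n.+1.
    by case: (Num.ceil (t / s)) c0 => // -[//|n] _; exists n.
  have := ceil_itv (t / s); rewrite cn => /andP[].
  have -> : (n.+1%:Z - 1)%:~R = n%:R :> R by rewrite -addn1 PoszD addrK.
  rewrite ltr_pdivlMr// ler_pdivrMr// => nt tn.
  have nw : (n < (Num.truncn (w / s)).+1)%N.
    rewrite ltnS truncn_ge_nat// ler_pdivlMr//; apply: ltW.
    exact: lt_le_trans tw.
  exists (Ordinal nw) => /=; move: tn.
  rewrite -[n.+1%:~R]/(n.+1%:R) -natr1 => tn.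
  rewrite gt_min nt /=.
  by rewrite minElt; case: ifPn => _; lra.
Qed.

Lemma rect_cover (R : realType) (a : R * R) (w h s : R) :
    0 < s -> s <= w -> s <= h ->
  exists (I : finType) (x : I -> R * R), [/\ #|I|%:R <= 4 * (w / s) * (h / s),
    forall i, square (x i) s `<=` rect a w h &
    rect a w h `<=` \bigcup_(i in [set: I]) square (x i) s].
Proof.
move=> s0 sw sh.
have [n [c [ns c01 ccov]]] := segment_cover s0 sw.
have [m [d [ms d01 dcov]]] := segment_cover s0 sh.
exists ('I_n * 'I_m)%type, (fun i => (a.1 + c i.1, a.2 + d i.2)); split.
- rewrite card_prod !card_ord natrM.
  rewrite (_ : 4 * _ * _ = (2 * w / s) * (2 * h / s)); last by ring.
  by apply: ler_pM => //; rewrite ler_pdivlMr.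
- move=> [i j] z; move: (c01 i) (d01 j) => /andP[? ?] /andP[? ?].
  move=> /rectP[/andP[/= ? ?] /andP[? ?]]; apply/rectP.
  by split; apply/andP; split; lra.
- move=> z /rectP[/andP[? ?] /andP[? ?]].
  have [|i /andP[? ?]] := ccov (z.1 - a.1); first by apply/andP; split; lra.
  have [|j /andP[? ?]] := dcov (z.2 - a.2); first by apply/andP; split; lra.
  exists (i, j) => //; apply/rectP => /=.
  by split; apply/andP; split; lra.
Qed.

Lemma macro_content_ge0 (R : realType) (rho : R) (k : nat) (A : set (R * R)) :
  (0 <= macro_content rho k A)%E.
Proof.
apply: le_ereal_inf_tmp => _ [m [x [r [_ _ _ ->]]]].
by rewrite lee_fin sumr_ge0// => i _; exact: powR_ge0.
Qed.

(** Coverings indexed by an arbitrary finite type, so that products and sums of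
    index types give grids and unions of coverings. *)
Lemma macro_content_le_cover (R : realType) (rho : R) (k : nat)
    (A : set (R * R)) (I : finType) (x : I -> R * R) (r : I -> R) :
    (forall i, 1 <= r i) -> (forall i, square (x i) (r i) `<=` shell k) ->
    A `&` shell k `<=` \bigcup_(i in [set: I]) square (x i) (r i) ->
  (macro_content rho k A <= (\sum_i (r i / expR k.+1%:R) `^ rho)%:E)%E.
Proof.
move=> r1 xsub Acov; apply: ge_ereal_inf; eexists; last exact: lexx.
exists #|I|, (x \o enum_val), (r \o enum_val); split => //=.
- by move=> z /Acov[i _ zi]; exists (enum_rank i) => //=; rewrite enum_rankK.
- by congr EFin; rewrite (reindex _ (onW_bij _ (enum_val_bij I))).
Qed.

Lemma le_macro_content (R : realType) (rho : R) (k : nat) (A B : set (R * R)) :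
  A `&` shell k `<=` B -> (macro_content rho k A <= macro_content rho k B)%E.
Proof.
move=> AB; apply: ereal_inf_le_tmp => _ [m [x [r [r1 xsub Bcov ->]]]].
by exists m, x, r; split => // z [Az kz]; apply: Bcov; split => //; exact: AB.
Qed.

Lemma macro_contentU (R : realType) (rho : R) (k : nat) (A B : set (R * R)) :
  (macro_content rho k (A `|` B) <=
    macro_content rho k A + macro_content rho k B)%E.
Proof.
have [->|Boo] := eqVneq (macro_content rho k B) +oo%E.
  by rewrite addey ?leey// gt_eqF// (lt_le_trans _ (macro_content_ge0 _ _ _)).
have Bfin : macro_content rho k B \is a fin_num.
  by rewrite ge0_fin_numE ?macro_content_ge0// ltey.
rewrite -leeBlDr//; apply: le_ereal_inf_tmp => _ [m [x [r [r1 xsub Acov ->]]]].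
rewrite leeBlDr// -leeBlDl//; apply: le_ereal_inf_tmp.
move=> _ [n [y [t [t1 ysub Bcov ->]]]]; rewrite leeBlDl// -EFinD.
pose xy i := match i with inl i => x i | inr j => y j end.
pose rt i := match i with inl i => r i | inr j => t j end.
have := @macro_content_le_cover R rho k (A `|` B) ('I_m + 'I_n)%type xy rt.
rewrite big_sumType/=; apply; try by case.
move=> z [[Az|Bz] kz].
- by have [i _ ?] := Acov z (conj Az kz); exists (inl i).
- by have [i _ ?] := Bcov z (conj Bz kz); exists (inr i).
Qed.

Lemma macro_content_rect_le (R : realType) (rho : R) (k : nat) (a : R * R)
    (w h s : R) :
    1 <= s -> s <= w -> s <= h -> rect a w h `<=` shell k ->
  (macro_content rho k (rect a w h) <=
    (4 * (w / s) * (h / s) * (s / expR k.+1%:R) `^ rho)%:E)%E.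
Proof.
move=> s1 sw sh rsub.
have [I [x [cardI xsub xcov]]] := rect_cover a (lt_le_trans ltr01 s1) sw sh.
apply: (le_trans (@macro_content_le_cover _ _ _ _ _ x (fun=> s) _ _ _)) => //.
- by move=> i; apply: subset_trans (xsub i) rsub.
- by move=> z [/xcov].
- rewrite lee_fin sumr_const -[X in X <= _]mulr_natl.
  by rewrite ler_wpM2r ?powR_ge0.
Qed.

(** A shell is the union of four overlapping rectangles, each of side lengths
    at least 1 and area at most [2 e^(2k)], hence covered by at most
    [8 e^(2k)] unit squares.  Besides bounding every dimension by 2, this makes
    all contents finite, so that finitely many shells never matter. *)
Lemma macro_content_shell_le (R : realType) (rho : R) (j : nat)
    (A : set (R * R)) : 0 < rho ->
  (macro_content rho j.+1 A <= (32 * expR ((2 - rho) * j.+1%:R))%:E)%E.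
Proof.
move=> rho0; set k := j.+1.
have e0 : 0 < expR j%:R :> R := expR_gt0 _.
have e1 : 1 <= expR j%:R :> R := expR_nat_ge1 R j.
have e2 : 2 * expR j%:R <= expR k%:R :> R := expRS_ge2 R j.
pose c : R := 8 * expR ((2 - rho) * k%:R).
have bound a w h : 1 <= w <= 2 * expR k%:R -> 1 <= h <= 2 * expR k%:R ->
    w * h <= 2 * expR k%:R ^+ 2 -> rect a w h `<=` shell k ->
    (macro_content rho k (rect a w h) <= c%:E)%E.
  move=> /andP[w1 w2] /andP[h1 h2] wh rsub.
  apply: (le_trans (@macro_content_rect_le _ rho k a w h 1 _ _ _ _)) => //.
  have c0 : 0 <= (1 / expR k.+1%:R : R) `^ rho := powR_ge0 _ _.
  have cE : (1 / expR k.+1%:R : R) `^ rho <= expR (- rho * k%:R).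
    rewrite div1r -expRN -expRM ler_expR mulrC mulNr mulrN lerN2.
    by rewrite ler_wpM2l ?ltW// ltr_nat.
  have -> : c = 4 * (2 * expR k%:R ^+ 2) * expR (- rho * k%:R).
    by rewrite /c mulrBl mulNr expRD (@expRM_natl _ 2); ring.
  rewrite lee_fin !divr1 -(mulrA 4); apply: ler_pM => //.
  - by rewrite !mulr_ge0//; lra.
  - by rewrite ler_wpM2l.
set u := expR j%:R in e0 e1 e2; set v := expR k%:R in e2 bound.
pose T := rect (- v, u) (2 * v) (v - u).
pose B := rect (- v, - v) (2 * v) (v - u).
pose L := rect (- v, - v) (v - u) (2 * v).
pose D := rect (u, - v) (v - u) (2 * v).
have subk a w h : - v <= a.1 -> a.1 + w <= v -> - v <= a.2 -> a.2 + h <= v ->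
    (forall z, rect a w h z -> ~ box j z) -> rect a w h `<=` shell k.
  move=> a1 aw a2 ah nbox z Rz; split; last exact: nbox.
  move/rectP: Rz => [/andP[? ?] /andP[? ?]]; apply/boxP.
  by rewrite -/v; split; apply/andP; split; lra.
have cT : (macro_content rho k T <= c%:E)%E.
  apply: bound; [by apply/andP; split; lra..|nra|].
  apply: subk => /=; [lra..|move=> z /rectP[_ /andP[/= ? _]]].
  by move=> /boxP[_ /andP[_]]; rewrite leNgt => /negP.
have cB : (macro_content rho k B <= c%:E)%E.
  apply: bound; [by apply/andP; split; lra..|nra|].
  apply: subk => /=; [lra..|move=> z /rectP[_ /andP[_ /= ?]]].
  by move=> /boxP[_ /andP[+ _]]; rewrite -/u => ?; lra.
have cL : (macro_content rho k L <= c%:E)%E.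
  apply: bound; [by apply/andP; split; lra..|nra|].
  apply: subk => /=; [lra..|move=> z /rectP[/andP[_ /= ?] _]].
  by move=> /boxP[/andP[+ _] _]; rewrite -/u => ?; lra.
have cD : (macro_content rho k D <= c%:E)%E.
  apply: bound; [by apply/andP; split; lra..|nra|].
  apply: subk => /=; [lra..|move=> z /rectP[/andP[/= ? _] _]].
  by move=> /boxP[/andP[_ +] _]; rewrite leNgt => /negP.
have -> : 32 * expR ((2 - rho) * k%:R) = c + (c + (c + c)) by rewrite /c; ring.
apply: (@le_trans _ _ (macro_content rho k (T `|` (B `|` (L `|` D))))).
  apply: le_macro_content => z [_ [/boxP[/andP[x1 x2] /andP[y1 y2]] nbox]].
  rewrite -/v in x1 x2 y1 y2.
  have [uy|yu] := ltP u z.2.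
    by left; apply/rectP => /=; split; apply/andP; split; lra.
  have [yu'|uy] := leP z.2 (- u).
    by right; left; apply/rectP => /=; split; apply/andP; split; lra.
  have [xu|ux] := leP z.1 (- u).
    by right; right; left; apply/rectP => /=; split; apply/andP; split; lra.
  right; right; right; apply/rectP => /=; split; last by apply/andP; split; lra.
  apply/andP; split; last lra.
  rewrite ltNge; apply/negP => xu; apply: nbox; apply/boxP.
  by rewrite -/u; split; apply/andP; split; lra.
rewrite !EFinD.
by do 3 (apply: (le_trans (macro_contentU _ _ _ _)); apply: leeD => //).
Qed.

(** * The mass distribution lower bound *)

(** The ascription selects the product of the two Borel sigma-algebras, on
    which the product of the Lebesgue measures lives. *)
Lemma measurable_rect (R : realType) (a : R * R) (w h : R) :
  measurable (rect a w h : set (measurableTypeR R * measurableTypeR R)).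
Proof. by apply: measurableX; exact: measurable_itv. Qed.

Lemma lebesgue_measure_itvoc_length (R : realType) (x w : R) : 0 <= w ->
  lebesgue_measure `]x, x + w] = w%:E.
Proof.
move=> w0; rewrite lebesgue_measure_itv/= lte_fin ltrDl -EFinB.
rewrite (addrC x) addrK.
by case: ltgtP w0 => // <-.
Qed.

Lemma rect_area (R : realType) (a : R * R) (w h : R) : 0 <= w -> 0 <= h ->
  ((@lebesgue_measure R) \x (@lebesgue_measure R))%E (rect a w h) =
  (w * h)%:E.
Proof.
move=> w0 h0; rewrite product_measure1E ?measurable_itv//.
rewrite EFinM; congr (_ * _)%E; exact: lebesgue_measure_itvoc_length.
Qed.

(** A square of side [r] meets a rectangle of width [w] in a set of width at
    most [min (r, w)] and height at most [r]; the areas of these traces must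
    add up to at least that of the rectangle. *)
Lemma rect_area_le_cover (R : realType) (a : R * R) (w h : R) (m : nat)
    (x : 'I_m -> R * R) (r : 'I_m -> R) :
    0 <= w -> 0 <= h -> (forall i, 0 <= r i) ->
    rect a w h `<=` \bigcup_(i in [set: 'I_m]) square (x i) (r i) ->
  w * h <= \sum_(i < m) r i * Num.min (r i) w.
Proof.
move=> w0 h0 r0 hcov; rewrite -lee_fin -(rect_area a w0 h0) -sumEFin.
pose mu : {measure set (measurableTypeR R * measurableTypeR R)%type -> \bar R}
  := ((@lebesgue_measure R) \x (@lebesgue_measure R))%E.
pose Q i := square (x i) (r i) `&` rect a w h.
have mQ i : measurable (Q i : set (measurableTypeR R * measurableTypeR R)).
  by apply: measurableI; exact: measurable_rect.
have hQ : rect a w h `<=` \bigcup_(i in [set: 'I_m]) Q i.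
  by move=> z hz; have [i _ ?] := hcov z hz; exists i.
apply: (@le_trans _ _ (\sum_(i \in [set: 'I_m]) mu (Q i))%E).
  have mR := measurable_rect a w h.
  exact: (@content_sub_fsum _ _ _ mu _ [set: 'I_m] (rect a w h) Q
    finite_finset (fun i _ => mQ i) mR hQ).
rewrite (fsbigE (index_enum 'I_m)) ?index_enum_uniq//; last first.
  by move=> i _; rewrite mem_index_enum.
under eq_bigl do rewrite in_setT.
apply: lee_sum => i _.
have muQ (S : set (measurableTypeR R * measurableTypeR R)) :
    measurable S -> Q i `<=` S -> (mu (Q i) <= mu S)%E.
  by move=> mS QS; apply: le_measure; rewrite ?inE.
have [rw|/ltW wr] := leP (r i) w.
- rewrite [leRHS](_ : _ = mu (rect (x i) (r i) (r i))); last first.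
    by rewrite /mu /= rect_area.
  apply: muQ; first exact: measurable_rect.
  by move=> z [].
- rewrite [leRHS](_ : _ = mu (rect (a.1, (x i).2) w (r i))); last first.
    by rewrite /mu /= rect_area// mulrC.
  apply: muQ; first exact: measurable_rect.
  by move=> z [/rectP[_ ?] /rectP[? _]]; exact/rectP.
Qed.

Lemma powRD_gt0 (R : realType) (x r s : R) :
  0 < x -> x `^ (r + s) = x `^ r * x `^ s.
Proof. by move=> x0; rewrite powRD// (gt_eqF x0) implybT. Qed.

(** Here [u] stands for the side of a square and [v] for the width of a
    strip.  If [u <= v] it compares
    [u ^ (s - 2)] with [v ^ (s - 2)], a nonpositive exponent; if [v <= u] it
    compares [v ^ (s - 1)] with [u ^ (s - 1)], a nonnegative one. *)
Lemma mul_min_powR_le (R : realType) (u v s : R) :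
  0 < u -> 0 < v -> 1 <= s <= 2 -> u * Num.min u v * v `^ (s - 2) <= u `^ s.
Proof.
move=> u0 v0 /andP[s1 s2].
have mono (x y t : R) : 0 < x -> x <= y -> 0 <= t -> x `^ t <= y `^ t.
  move=> x0 xy t0; apply: ge0_ler_powR => //; rewrite nnegrE ltW//.
  exact: lt_le_trans xy.
have [u0' v0'] := (ltW u0, ltW v0).
rewrite -(@mulr_powRB1 _ u)//; last lra.
rewrite -mulrA ler_wpM2l//; case: (leP u v) => [uv|/ltW vu].
- rewrite (_ : s - 1 = 1 + (s - 2)); last ring.
  rewrite (@powRD_gt0 _ u)// powRr1// ler_wpM2l//.
  rewrite -[s - 2]opprB !powRN lef_pV2 ?posrE ?powR_gt0// mono//; lra.
- rewrite -{1}(powRr1 v0') -(@powRD_gt0 _ v 1)//.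
  by rewrite (_ : 1 + (s - 2) = s - 1) ?mono//; lra.
Qed.

(** The side of an admissible square is at most the scale [e^(k+1)], so the
    terms [(r / e^(k+1)) ^ rho] decrease in [rho]. *)
Lemma square_side_le (R : realType) (k : nat) (x : R * R) (r : R) :
  0 < r -> square x r `<=` shell k -> r <= expR k.+1%:R.
Proof.
move=> r0 xk; apply: le_trans (expRS_ge2 R k).
set e := expR k%:R.
have xbox z : square x r z -> box k z by move=> /xk/shell_sub_box.
have /xbox/boxP[/andP[_ /= xr] _] : square x r (x.1 + r, x.2 + r).
  by apply/rectP; split; apply/andP; split=> /=; lra.
rewrite -/e in xr; have [ex|xe] := leP (- e) x.1; first lra.
(* Otherwise the square sticks out of the box on the left. *)
have /xbox/boxP[/andP[/= ex _] _] :
    square x r (Num.min (x.1 + r) (- e), x.2 + r).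
  apply/rectP; split; apply/andP; split=> /=; try lra.
  - by rewrite lt_min xe andbT; lra.
  - by rewrite ge_min lexx.
by move: ex; rewrite lt_min ltxx andbF.
Qed.

(** The two exponents serve different purposes: [s] is the one at which the
    area argument is run, and [rho <= s] is allowed because contents decrease
    in the exponent. *)
Lemma macro_content_rect_ge (R : realType) (rho s : R) (k : nat)
    (A : set (R * R)) (a : R * R) (w h : R) :
    rho <= s -> 1 <= s <= 2 -> 0 < w -> 0 <= h ->
    rect a w h `<=` A `&` shell k ->
  (((w / expR k.+1%:R) `^ (s - 1) * (h / expR k.+1%:R))%:E <=
    macro_content rho k A)%E.
Proof.
move=> rhos s12 w0 h0 Rsub; apply: le_ereal_inf_tmp.
move=> _ [m [x [r [r1 xsub Acov ->]]]]; rewrite lee_fin.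
set E := expR k.+1%:R; have E0 : 0 < E := expR_gt0 _.
have r0 i : 0 < r i := lt_le_trans ltr01 (r1 i).
have v0 : 0 < w / E by rewrite divr_gt0.
apply: (@le_trans _ _ (\sum_(i < m) (r i / E) `^ s)); last first.
  apply: ler_sum => i _; apply: ger_powR => //.
  by rewrite divr_gt0// ler_pdivrMr// mul1r (square_side_le (r0 i) (xsub i)).
apply: (@le_trans _ _
    (\sum_(i < m) r i / E * Num.min (r i / E) (w / E) * (w / E) `^ (s - 2)));
  last by apply: ler_sum => i _; rewrite mul_min_powR_le ?divr_gt0.
have area : w * h <= \sum_(i < m) r i * Num.min (r i) w.
  apply: (@rect_area_le_cover _ a w h m x r (ltW w0) h0 (fun i => ltW (r0 i))).
  exact: (subset_trans Rsub Acov).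
rewrite (_ : s - 1 = 1 + (s - 2)); last ring.
rewrite (@powRD_gt0 _ _ 1)// (powRr1 (ltW v0)) -mulr_suml.
rewrite mulrAC ler_wpM2r ?powR_ge0//.
have -> : w / E * (h / E) = E^-2 * (w * h) by field; rewrite gt_eqF.
have -> : \sum_(i < m) r i / E * Num.min (r i / E) (w / E) =
    E^-2 * (\sum_(i < m) r i * Num.min (r i) w).
  rewrite mulr_sumr; apply: eq_bigr => i _.
  rewrite -minr_pMl ?invr_ge0 ?ltW//.
  by field; rewrite gt_eqF.
by rewrite ler_wpM2l// invr_ge0 exprn_ge0// ltW.
Qed.

(** * Convergence and divergence of series *)

Lemma nneseries_bounded (R : realType) (u : nat -> R) (M : R) :
    (forall i, 0 <= u i) -> (forall n, \sum_(i < n) u i <= M) ->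
  (\sum_(i <oo) (u i)%:E < +oo)%E.
Proof.
move=> u0 uM; apply: (@le_lt_trans _ _ M%:E); last exact: ltry.
apply: lime_le; first by apply: is_cvg_nneseries => n _ _; rewrite lee_fin.
by apply: nearW => n; rewrite big_mkord sumEFin lee_fin.
Qed.

Lemma nneseries_near_lt_pinfty (R : realType) (v : nat -> \bar R)
    (u : nat -> R) :
    (forall j, 0 <= v j < +oo)%E -> (forall j, 0 <= u j) ->
    (\forall j \near \oo, (v j <= (u j)%:E)%E) ->
    (\sum_(j <oo) (u j)%:E < +oo)%E ->
  (\sum_(j <oo) v j < +oo)%E.
Proof.
move=> v0 u0 [N _ vu] ufin.
have v0' j : (0 <= v j)%E by case/andP: (v0 j).
have u0' j : (0 <= (u j)%:E)%E by rewrite lee_fin.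
rewrite (@nneseries_split _ _ 0 N)// add0n; apply: lte_add_pinfty.
  by apply: lte_sum_pinfty => j _; case/andP: (v0 j).
apply: le_lt_trans ufin.
rewrite [leRHS](@nneseries_split _ _ 0 N)// add0n.
apply: (@le_trans _ _ (\sum_(N <= j <oo) (u j)%:E)%E); last first.
  by apply: leeDr; rewrite sume_ge0.
rewrite -(nneseries_addn N v0') -(nneseries_addn N u0').
apply: lee_nneseries => // j _.
by apply: vu => /=; rewrite leq_addl.
Qed.

Lemma nneseries_expR_lt_pinfty (R : realType) (c : R) : 0 < c ->
  (\sum_(j <oo) (expR (- (c * j%:R)))%:E < +oo)%E.
Proof.
move=> c0; set x := expR (- c).
have [x0 x1] : 0 < x /\ x < 1 by rewrite expR_gt0 expR_lt1 oppr_lt0.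
apply: (@nneseries_bounded _ _ (1 - x)^-1) => [i|n]; first exact: expR_ge0.
under eq_bigr do rewrite -mulNr expRM_natr -/x.
rewrite -[leRHS]mul1r ler_pdivlMr ?subr_gt0// mulrC.
have := subrX1 x n; have : 0 <= x ^+ n by rewrite exprn_ge0// ltW.
by move=> ? xn; lra.
Qed.

(** With [d = c - 1], the terms are dominated by the telescoping differences
    [k^-d - (k+1)^-d], up to the factor [d]. *)
Lemma nneseries_powRN_lt_pinfty (R : realType) (c : R) : 1 < c ->
  (\sum_(j <oo) (j.+1%:R `^ (- c))%:E < +oo)%E.
Proof.
move=> c1; set d := c - 1; have d0 : 0 < d by rewrite subr_gt0.
apply: (@nneseries_bounded _ _ (1 + d^-1)) => [i|n]; first exact: powR_ge0.
have step k : d * k.+2%:R `^ (- c) <= k.+1%:R `^ (- d) - k.+2%:R `^ (- d) :> R.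
  have k1 : 0 < k.+1%:R :> R by rewrite ltr0n.
  have k2 : 0 < k.+2%:R :> R by rewrite ltr0n.
  have -> : - c = - d + -1 by rewrite /d; ring.
  have ratio : 1 + d / k.+2%:R <= (k.+1%:R / k.+2%:R) `^ (- d) :> R.
    (* Two tangent line bounds: e^x >= 1 + x, and ln (1 - 1/b) <= - 1/b. *)
    rewrite /powR gt_eqF ?divr_gt0//; apply: le_trans (expR_ge1Dx _).
    rewrite lerD2l mulNr -mulrN (ler_wpM2l (ltW d0))//.
    have := @le_ln1Dx R (- k.+2%:R^-1).
    rewrite ltrN2 invf_lt1 ?ltr1n// => /(_ isT).
    rewrite (_ : 1 - _ = k.+1%:R / k.+2%:R); first by rewrite lerNr.
    by rewrite -[k.+1%:R](addrK 1) natr1; field; rewrite gt_eqF.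
  have -> : k.+1%:R `^ (- d) =
      k.+2%:R `^ (- d) * (k.+1%:R / k.+2%:R) `^ (- d) :> R.
    by rewrite -powRM ?divr_ge0// mulrC divfK// gt_eqF.
  rewrite powRD_gt0// powR_inv1//.
  set y := k.+2%:R `^ (- d); set b := k.+2%:R^-1 in ratio *.
  have -> : d * (y * b) = y * (1 + d * b) - y by ring.
  by rewrite lerD2r ler_wpM2l// powR_ge0.
have sums m : d * \sum_(i < m) i.+2%:R `^ (- c) <= 1 - m.+1%:R `^ (- d) :> R.
  elim: m => [|m IHm]; first by rewrite big_ord0 mulr0 powR1 subrr.
  by rewrite big_ord_recr/= mulrDr; have := step m; lra.
case: n => [|n]; first by rewrite big_ord0 addr_ge0// invr_ge0 ltW.
rewrite big_ord_recl/= powR1 lerD2l -[leRHS]mulr1 ler_pdivlMl//.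
by apply: le_trans (sums n) _; rewrite lerBlDr lerDl powR_ge0.
Qed.

Lemma nneseries_harmonic (R : realType) :
  (\sum_(j <oo) (j.+1%:R^-1)%:E = +oo :> \bar R)%E.
Proof.
apply/eqP; rewrite -leye_eq leNgt; apply/negP => fin.
apply: (@dvg_harmonic R); apply: nnseries_is_cvg => // i.
by rewrite invr_ge0.
Qed.

Lemma nneseries1 (R : realType) : (\sum_(j <oo) 1%:E = +oo :> \bar R)%E.
Proof.
apply/eqP; rewrite -leye_eq -(nneseries_harmonic R).
apply: lee_nneseries => j _; rewrite lee_fin ?invr_ge0//.
by rewrite invf_le1// ler1n.
Qed.

Lemma nneseries_from1 (R : realType) (v : nat -> \bar R) :
  (forall k, 0 <= v k)%E ->
  (\sum_(1 <= k <oo) v k = \sum_(j <oo) v j.+1)%E.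
Proof.
move=> v0; rewrite -(nneseries_addn 1 v0).
by apply: eq_eseriesr => j _; rewrite addn1.
Qed.

(** * Criteria for the dimension *)

(** Bounds on the content are only needed in all but finitely many shells, the
    remaining contents being finite by [macro_content_shell_le]. *)
Lemma macro_hausdorff_dim_le (R : realType) (A : set (R * R)) (s : R) :
    0 <= s ->
    (forall rho, s < rho -> exists u : nat -> R,
      [/\ forall j, 0 <= u j,
          \forall j \near \oo, (macro_content rho j.+1 A <= (u j)%:E)%E &
          (\sum_(j <oo) (u j)%:E < +oo)%E]) ->
  (macro_hausdorff_dim A <= s%:E)%E.
Proof.
move=> s0 Au; apply/lee_addgt0Pr => e e0.
have [|u [u0 Aleu ufin]] := Au (s + e); first by rewrite ltrDl.
apply: ge_ereal_inf; exists (s + e)%:E => //; exists (s + e) => //.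
have rho0 : 0 < s + e by rewrite ltr_wpDl.
split => //; rewrite (nneseries_from1 (fun k => macro_content_ge0 _ k A)).
apply: nneseries_near_lt_pinfty Aleu ufin => // j.
rewrite macro_content_ge0/=.
exact: le_lt_trans (macro_content_shell_le _ _ rho0) (ltry _).
Qed.

Lemma macro_hausdorff_dim_ge (R : realType) (A : set (R * R)) (s : R)
    (u : nat -> R) :
    (forall j, 0 <= u j) ->
    (forall rho j, rho <= s -> ((u j)%:E <= macro_content rho j.+1 A)%E) ->
    (\sum_(j <oo) (u j)%:E = +oo)%E ->
  (s%:E <= macro_hausdorff_dim A)%E.
Proof.
move=> u0 uA uoo; apply: le_ereal_inf_tmp => _ [rho [_ Afin] <-].
rewrite lee_fin leNgt; apply/negP => rhos; move: Afin.
rewrite (nneseries_from1 (fun k => macro_content_ge0 _ k A)) ltNge => /negP.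
apply.
rewrite -uoo; apply: lee_nneseries => j _; first by rewrite lee_fin.
by apply: uA; exact: ltW.
Qed.

Lemma macro_hausdorff_dim_le2 (R : realType) (A : set (R * R)) :
  (macro_hausdorff_dim A <= 2%:E)%E.
Proof.
apply: macro_hausdorff_dim_le => // rho rho2.
exists (fun j => 32 * expR (- ((rho - 2) * j%:R))); split.
- by move=> j; rewrite mulr_ge0// expR_ge0.
- apply: nearW => j.
  apply: (le_trans (macro_content_shell_le _ _ _)); first by lra.
  rewrite lee_fin ler_pM2l// ler_expR -mulNr opprB.
  by rewrite ler_wnM2l ?ler_nat//; lra.
- under eq_eseriesr do rewrite EFinM.
  rewrite nneseriesZl => [|j _]; last by rewrite lee_fin expR_ge0.
  rewrite lte_mul_pinfty ?lee_fin//.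
  by rewrite nneseries_expR_lt_pinfty// subr_gt0.
Qed.

(** The width is measured in units of [e^j]: the content of the strip is then
    of order [d ^ (rho - 1)], whatever [j]. *)
Definition strip {R : realType} (j : nat) (d : R) : set (R * R) :=
  rect (0, expR j%:R) (d * expR j%:R) (expR j.+1%:R - expR j%:R).

Lemma stripP (R : realType) (j : nat) (d : R) (z : R * R) :
  strip j d z <-> (0 < z.1 <= d * expR j%:R) /\
                  (expR j%:R < z.2 <= expR j.+1%:R).
Proof. by rewrite /strip rectP/= add0r subrKC. Qed.

Lemma strip_sub_shell (R : realType) (j : nat) (d : R) :
  d <= 1 -> strip j d `<=` shell j.+1.
Proof.
move=> d1 z /stripP[/andP[z1 z1d] /andP[z2 z2e]].
have := expRS_ge2 R j; have e0 := expR_gt0 (j%:R : R).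
have : d * expR j%:R <= 1 * expR j%:R by rewrite ler_wpM2r// ltW.
move=> ? ?; split.
- by apply/boxP; split; apply/andP; split; lra.
- by move=> /boxP[_ /andP[_]]; rewrite leNgt z2.
Qed.

(** The exponent is confined to [[1, 2]] by the range of the interpolation
    inequality; at the left end [s = 1] the widths become irrelevant. *)
Lemma macro_hausdorff_dim_ge_strip (R : realType) (A : set (R * R)) (s : R)
    (d : nat -> R) :
    1 <= s <= 2 -> (forall j, 0 < d j <= 1) ->
    (forall j, strip j (d j) `<=` A) ->
    (\sum_(j <oo) (d j `^ (s - 1))%:E = +oo)%E ->
  (s%:E <= macro_hausdorff_dim A)%E.
Proof.
move=> s12 d01 dA doo.
pose e2 : R := expR 1 ^- 2.
have e20 : 0 < e2 by rewrite invr_gt0 exprn_gt0// expR_gt0.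
pose c := e2 `^ (s - 1) * ((expR 1 - 1) * e2).
have c0 : 0 < c.
  by rewrite mulr_gt0 ?powR_gt0// mulr_gt0// subr_gt0 expR_gt1.
have cd0 j : 0 <= c * d j `^ (s - 1) by rewrite mulr_ge0 ?powR_ge0// ltW.
apply: (macro_hausdorff_dim_ge cd0) => [rho j rhos|].
- have /andP[dj0 dj1] := d01 j; have ej := expR_gt0 (j%:R : R).
  have e1 : 0 < expR 1 :> R := expR_gt0 _.
  have h0 : 0 <= expR j.+1%:R - expR j%:R :> R.
    by rewrite subr_ge0 ler_expR ler_nat.
  have Rsub : strip j (d j) `<=` A `&` shell j.+1.
    move=> z jz; split; first exact: (dA j).
    exact: strip_sub_shell dj1 _ jz.
  have := macro_content_rect_ge rhos s12 (mulr_gt0 dj0 ej) h0 Rsub.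
  apply: le_trans; rewrite lee_fin.
  have -> : d j * expR j%:R / expR j.+2%:R = d j * e2.
    by rewrite /e2 !expRS; field; rewrite !gt_eqF.
  have -> : (expR j.+1%:R - expR j%:R) / expR j.+2%:R = (expR 1 - 1) * e2.
    by rewrite /e2 !expRS; field; rewrite !gt_eqF.
  rewrite powRM; [|exact: ltW..].
  by rewrite /c mulrAC (mulrC (_ `^ _) (d j `^ _)).
- under eq_eseriesr do rewrite EFinM.
  rewrite nneseriesZl => [|j _]; last by rewrite lee_fin powR_ge0.
  by rewrite doo gt0_muley// lte_fin.
Qed.

(** The strip is covered by squares of its own width [d_j e^j]; this side must
    be at least 1 to be admissible, and at most the height
    [e^(j+1) - e^j >= e^j] of the strip, whence [d_j <= 1]. *)
Lemma macro_hausdorff_dim_le_strip (R : realType) (A : set (R * R)) (s : R)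
    (d : nat -> R) :
    0 <= s -> (forall j, 0 < d j) ->
    (\forall j \near \oo, [/\ d j <= 1, 1 <= d j * expR j%:R &
      A `&` shell j.+1 `<=` strip j (d j)]) ->
    (forall rho, s < rho -> (\sum_(j <oo) (d j `^ (rho - 1))%:E < +oo)%E) ->
  (macro_hausdorff_dim A <= s%:E)%E.
Proof.
move=> s0 d0 Ad dfin; apply: macro_hausdorff_dim_le => // rho srho.
have e1 : 0 < expR 1 :> R := expR_gt0 _.
pose c : R := 4 * (expR 1 - 1) * (expR 1 ^- 2) `^ rho.
have c0 : 0 <= c.
  by rewrite !mulr_ge0 ?powR_ge0// subr_ge0 ltW// expR_gt1.
exists (fun j => c * d j `^ (rho - 1)); split.
- by move=> j; rewrite mulr_ge0// powR_ge0.
- apply: filterS Ad => j [d1 w1 Asub].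
  have ej := expR_gt0 (j%:R : R); have dj0 := d0 j.
  apply: (le_trans (le_macro_content _ Asub)).
  have wh : d j * expR j%:R <= expR j.+1%:R - expR j%:R.
    have := expRS_ge2 R j.
    have : d j * expR j%:R <= 1 * expR j%:R by rewrite ler_wpM2r// ltW.
    lra.
  have := macro_content_rect_le rho w1 (lexx _) wh (strip_sub_shell d1).
  move=> /le_trans; apply; rewrite lee_fin.
  have -> : d j * expR j%:R / expR j.+2%:R = d j * expR 1 ^- 2.
    by rewrite !expRS; field; rewrite !gt_eqF.
  have -> : (expR j.+1%:R - expR j%:R) / (d j * expR j%:R) =
      (expR 1 - 1) / d j.
    by rewrite !expRS; field; rewrite !gt_eqF.
  have e20 : 0 <= expR 1 ^- 2 :> R by rewrite invr_ge0 exprn_ge0// ltW.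
  rewrite divff ?gt_eqF ?mulr_gt0// mulr1.
  rewrite (powRM _ (ltW dj0) e20) /c powRD_gt0// (powR_inv1 (ltW dj0)).
  by rewrite le_eqVlt; apply/orP; left; apply/eqP; ring.
- under eq_eseriesr do rewrite EFinM.
  rewrite nneseriesZl => [|j _]; last by rewrite lee_fin powR_ge0.
  by rewrite lte_mul_pinfty ?lee_fin// dfin.
Qed.

(** * The two epigraphs *)

(** A point of a shell in the positive quadrant is high or far to the right;
    near or above the diagonal it has to be high. *)
Lemma shell_above_diagonal (R : realType) (j : nat) (z : R * R) :
    shell j.+1 z -> 0 < z.1 -> 0 < z.2 -> z.1 <= Num.max 1 z.2 ->
  expR j%:R < z.2 <= expR j.+1%:R.
Proof.
move=> [/boxP[_ /andP[_ ->]] nbox] z1 z2 z12; rewrite andbT ltNge.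
apply/negP => z2e; apply: nbox; apply/boxP; have e1 := expR_nat_ge1 R j.
have : Num.max 1 z.2 <= expR j%:R by rewrite ge_max e1.
by move=> ?; split; apply/andP; split; lra.
Qed.

Lemma log_plus_ge1 (R : realType) (y : R) : 1 <= log_plus y.
Proof.
rewrite /log_plus -[leLHS]expRK ler_ln ?posrE ?lt_max ?expR_gt0 ?orbT//.
by rewrite le_max lexx orbT.
Qed.

Lemma log_plus_le (R : realType) (y t : R) :
  1 <= t -> y <= expR t -> log_plus y <= t.
Proof.
move=> t1 yt; rewrite /log_plus -[leRHS]expRK ler_ln ?posrE ?expR_gt0//.
  by rewrite ge_max yt ler_expR.
by rewrite lt_max expR_gt0 orbT.
Qed.

Lemma log_plus_ge (R : realType) (y t : R) : expR t <= y -> t <= log_plus y.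
Proof.
move=> ty; rewrite /log_plus -[leLHS]expRK ler_ln ?posrE ?expR_gt0//.
  by rewrite le_max ty.
by rewrite lt_max expR_gt0 orbT.
Qed.

(** With [r] the square root of [t], [p ln t = 2 p ln r <= 2 p r <= r ^ 2]. *)
Lemma powR_le_expR (R : realType) (p t : R) :
  0 < p -> (2 * p) ^+ 2 <= t -> t `^ p <= expR t.
Proof.
move=> p0 pt.
have t0 : 0 < t by rewrite (lt_le_trans _ pt)// exprn_gt0// mulr_gt0.
set r := Num.sqrt t; have r0 : 0 < r by rewrite sqrtr_gt0.
have tr : t = r ^+ 2 by rewrite sqr_sqrtr// ltW.
have pr : 2 * p <= r.
  by rewrite -ler_sqr ?nnegrE ?(ltW r0) ?mulr_ge0 ?(ltW p0)// -tr.
rewrite /powR gt_eqF// ler_expR tr lnXn// -mulr_natl mulrA (mulrC p).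
apply: (@le_trans _ _ (2 * p * r)).
  by rewrite ler_wpM2l ?mulr_ge0 ?(ltW p0)// ltW// ln_sublinear.
by rewrite expr2 ler_wpM2r// ltW.
Qed.

(** If [x <= (j+1)^-p e^j] then [log_plus x <= j + 1], hence
    [x (log_plus x)^p <= e^j].  At the exponent [1 + 1/p] these widths produce
    the harmonic series, so that no convergence is left even at the critical
    value. *)
Lemma log_epigraph_dim_ge (R : realType) (p : R) : 1 < p ->
  ((1 + p^-1)%:E <= macro_hausdorff_dim (log_epigraph p))%E.
Proof.
move=> p1; have p0 : 0 < p := lt_trans ltr01 p1.
have pV : 0 < p^-1 < 1 by rewrite invr_gt0 p0 invf_lt1.
apply: (@macro_hausdorff_dim_ge_strip _ _ _ (fun j => j.+1%:R `^ (- p))).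
- by move/andP: pV => [? ?]; apply/andP; split; lra.
- move=> j; rewrite powR_gt0//= powRN invf_le1 ?powR_gt0//.
  by rewrite -[leLHS](powRr0 j.+1%:R) ler_powR ?ler1n// ltW.
- move=> j z /stripP[/andP[z1 z1le] /andP[z2 _]].
  have ej := expR_gt0 (j%:R : R).
  have jp : 0 < j.+1%:R `^ p :> R by rewrite powR_gt0.
  split => //; first exact: lt_trans z2.
  apply: le_trans (ltW z2).
  have z1e : z.1 <= expR j.+1%:R.
    apply: (le_trans z1le); rewrite -[leRHS]mul1r; apply: ler_pM => //.
    + rewrite powRN invf_le1//.
      by rewrite -[leLHS](powRr0 j.+1%:R) ler_powR ?ler1n// ltW.
    + by rewrite ler_expR ler_nat.
  have logp : log_plus z.1 `^ p <= j.+1%:R `^ p.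
    have l1 := log_plus_ge1 z.1.
    rewrite ge0_ler_powR ?nnegrE ?(ltW p0)//; first exact: le_trans l1.
    by apply: log_plus_le => //; rewrite ler1n.
  apply: (@le_trans _ _ (j.+1%:R `^ (- p) * expR j%:R * j.+1%:R `^ p)).
    by apply: ler_pM => //; [exact: ltW|exact: powR_ge0].
  by rewrite powRN mulrAC mulVf ?mul1r// gt_eqF.
- rewrite -(nneseries_harmonic R); apply: eq_eseriesr => j _; congr EFin.
  rewrite (_ : 1 + p^-1 - 1 = p^-1); last ring.
  by rewrite -powRrM mulNr divff ?gt_eqF// powR_inv1.
Qed.

(** Put [t = (j+1) / 2].  A point of height at most [e^(j+1) = e^(2 t)] with
    [x > e^t] has [log_plus x >= t], hence [x <= e^(2 t) t^-p]; and if
    [x <= e^t] the same bound holds because eventually [t^p <= e^t]. *)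
Lemma log_epigraph_dim_le (R : realType) (p : R) : 1 < p ->
  (macro_hausdorff_dim (log_epigraph p) <= (1 + p^-1)%:E)%E.
Proof.
move=> p1; have p0 : 0 < p := lt_trans ltr01 p1.
pose t (j : nat) : R := j.+1%:R / 2.
have t0 j : 0 < t j by rewrite divr_gt0.
have tp0 j : 0 < t j `^ p by rewrite powR_gt0.
apply: (@macro_hausdorff_dim_le_strip _ _ _ (fun j => expR 1 * t j `^ (- p))).
- by rewrite addr_ge0// invr_ge0 ltW.
- by move=> j; rewrite mulr_gt0 ?expR_gt0// powR_gt0.
- near=> j.
  have de : expR 1 * t j `^ (- p) * expR j%:R = expR j.+1%:R / t j `^ p.
    by rewrite powRN mulrAC -expRS.
  have tt : expR (t j) * expR (t j) = expR j.+1%:R.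
    by rewrite -expRD /t -splitr.
  have tpe : t j `^ p <= expR (t j).
    apply: powR_le_expR => //; rewrite /t ler_pdivlMr//.
    apply: (@le_trans _ _ j%:R); last by rewrite ler_nat.
    near: j; exact: nbhs_infty_ger.
  have et : expR 1 <= t j `^ p.
    have tj : expR 1 <= t j.
      rewrite /t ler_pdivlMr//.
      apply: (@le_trans _ _ j%:R); last by rewrite ler_nat.
      near: j; exact: nbhs_infty_ger.
    apply: (le_trans tj); apply: le1r_powR; last exact: ltW.
    by apply: le_trans tj; have := expR1_ge2 R; lra.
  have et1 : 1 <= expR (t j) by rewrite -expR0 ler_expR ltW.
  rewrite de; split.
  + by rewrite powRN ler_pdivrMr// mul1r.
  + rewrite ler_pdivlMr// mul1r -tt (le_trans tpe)// ler_peMr//.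
  + move=> z [[z1 z2 z12] jz]; have l1 := log_plus_ge1 z.1.
    have lp1 : 1 <= log_plus z.1 `^ p.
      by rewrite -[leLHS](powRr0 (log_plus z.1)) ler_powR// ltW.
    have z12' : z.1 <= z.2 by apply: le_trans z12; rewrite ler_peMr// ltW.
    have /andP[z2j z2e] : expR j%:R < z.2 <= expR j.+1%:R.
      by apply: shell_above_diagonal => //; rewrite le_max z12' orbT.
    apply/stripP; rewrite z2j z2e de z1 ler_pdivlMr//; split => //.
    have [z1t|tz1] := leP z.1 (expR (t j)).
      by rewrite -tt; apply: ler_pM => //; exact: ltW.
    apply: le_trans z2e; apply: le_trans z12; rewrite (ler_wpM2l (ltW z1))//.
    rewrite ge0_ler_powR ?nnegrE ?(ltW p0) ?(ltW (t0 j)) ?(le_trans ler01 l1)//.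
    by apply: log_plus_ge; exact: ltW.
- move=> rho rhop; set s := rho - 1.
  have sp : p^-1 < s by rewrite /s ltrBrDl.
  pose C : R := (expR 1 * 2 `^ p) `^ s.
  have dE j : (expR 1 * t j `^ (- p)) `^ s = C * j.+1%:R `^ (- (p * s)).
    have -> : t j `^ (- p) = 2 `^ p * j.+1%:R `^ (- p).
      rewrite !powRN /t powRM ?invr_ge0// -(@powR_inv1 _ 2)// powRAC.
      by rewrite powR_inv1 ?powR_ge0// invfM invrK mulrC.
    by rewrite mulrA powRM ?mulr_ge0 ?powR_ge0 ?expR_ge0// -powRrM mulNr.
  under eq_eseriesr do rewrite dE EFinM.
  rewrite nneseriesZl => [|j _]; last by rewrite lee_fin powR_ge0.
  rewrite lte_mul_pinfty ?lee_fin ?powR_ge0//.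
  by rewrite nneseries_powRN_lt_pinfty// mulrC -ltr_pdivrMr// div1r.
Unshelve. all: by end_near. Qed.

Lemma power_epigraph_dim_ge1 (R : realType) (q : R) : 0 < q ->
  (1%:E <= macro_hausdorff_dim (power_epigraph q))%E.
Proof.
move=> q0.
apply: (@macro_hausdorff_dim_ge_strip _ _ _ (fun j => expR (- j%:R))).
- by apply/andP; split; lra.
- by move=> j; rewrite expR_gt0 expR_le1 oppr_le0 ler0n.
- move=> j z /stripP[/andP[z1 +] /andP[z2 _]]; rewrite expRN mulVf ?expR_eq0//.
  have e1 := expR_nat_ge1 R j => z11.
  split => //; first exact: lt_trans (expR_gt0 _) z2.
  apply: le_trans (ltW z2); apply: le_trans e1.
  rewrite -[leRHS](powRr0 z.1); apply: ger_powR; last exact: ltW.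
  by rewrite z1.
- rewrite -(nneseries1 R); apply: eq_eseriesr => j _.
  by rewrite subrr powRr0.
Qed.

Lemma power_epigraph_dim_ge2 (R : realType) (q : R) : 0 < q -> q <= 1 ->
  (2%:E <= macro_hausdorff_dim (power_epigraph q))%E.
Proof.
move=> q0 q1; apply: (@macro_hausdorff_dim_ge_strip _ _ _ (fun=> 1)).
- by apply/andP; split; lra.
- by move=> j; rewrite ltr01 lexx.
- move=> j z /stripP[/andP[z1 +] /andP[z2 _]]; rewrite mul1r => z1e.
  split => //; first exact: lt_trans (expR_gt0 _) z2.
  apply: le_trans (ltW z2).
  apply: (@le_trans _ _ (expR j%:R `^ q)).
    by rewrite ge0_ler_powR ?nnegrE ?expR_ge0 ?(ltW q0) ?(ltW z1)//.
  by apply: ler1_powR => //; exact: expR_nat_ge1.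
- rewrite -(nneseries1 R); apply: eq_eseriesr => j _.
  by rewrite powR1.
Qed.

(** Below height [e^(j+1)] the abscissas are at most [e^((j+1) / q)], which is
    exponentially small compared with [e^j]. *)
Lemma power_epigraph_dim_le1 (R : realType) (q : R) : 1 < q ->
  (macro_hausdorff_dim (power_epigraph q) <= 1%:E)%E.
Proof.
move=> q1; have q0 : 0 < q := lt_trans ltr01 q1.
have qV1 : 0 < 1 - q^-1 by rewrite subr_gt0 invf_lt1.
pose d (j : nat) : R := expR (j.+1%:R / q - j%:R).
apply: (@macro_hausdorff_dim_le_strip _ _ _ d) => //.
- by move=> j; exact: expR_gt0.
- near=> j.
  have de : d j * expR j%:R = expR (j.+1%:R / q) by rewrite -expRD subrK.
  rewrite de; split.
  + rewrite expR_le1 subr_le0 ler_pdivrMr// -natr1 -lerBrDl -[X in _ - X]mulr1.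
    rewrite -mulrBr -ler_pdivrMr ?subr_gt0//.
    near: j; exact: nbhs_infty_ger.
  + by rewrite -expR0 ler_expR divr_ge0// ltW.
  + move=> z [[z1 z2 z12] jz].
    have z1max : z.1 <= Num.max 1 z.2.
      rewrite le_max; have [//|/ltW z1ge] := leP z.1 1.
      by rewrite (le_trans _ z12) ?orbT// le1r_powR// ltW.
    have /andP[z2j z2e] := shell_above_diagonal jz z1 z2 z1max.
    apply/stripP; rewrite z2j z2e de z1; split => //.
    rewrite leNgt; apply/negP => ez.
    have := gt0_ltr_powR q0 _ _ ez; rewrite !nnegrE expR_ge0 ltW//.
    move=> /(_ isT isT); rewrite -expRM divfK ?gt_eqF//.
    by rewrite ltNge (le_trans z12).
- move=> rho rho1; set s := rho - 1; have s0 : 0 < s by rewrite subr_gt0.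
  have dE j : d j `^ s = expR (s / q) * expR (- (s * (1 - q^-1) * j%:R)).
    rewrite -expRM -expRD; congr expR; rewrite -natr1; ring.
  under eq_eseriesr do rewrite dE EFinM.
  rewrite nneseriesZl => [|j _]; last by rewrite lee_fin expR_ge0.
  rewrite lte_mul_pinfty ?lee_fin ?expR_ge0//.
  by rewrite nneseries_expR_lt_pinfty// mulr_gt0.
Unshelve. all: by end_near. Qed.

Theorem corollary1p4 (R : realType) (p q : R) (hp : 1 < p) (hq : 0 < q) :
  macro_hausdorff_dim (log_epigraph p) = (1 + p^-1)%:E /\
  macro_hausdorff_dim (power_epigraph q) = (if q <= 1 then 2 else 1 : R)%:E.
Proof.
split; first by apply/le_anti; rewrite log_epigraph_dim_le ?log_epigraph_dim_ge.
apply/le_anti; case: (leP q 1) => q1.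
- by rewrite macro_hausdorff_dim_le2 power_epigraph_dim_ge2.
- by rewrite power_epigraph_dim_le1 ?power_epigraph_dim_ge1.
Qed.
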